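(* Let $k$ be an algebraically closed field of characteristic $0$ and $R=k\langle x,y\rangle/(xy-yx-y^2)$. For $a\in k$ let $S_a$ be the one-dimensional $R$-module $ku$ with $xu=au$, $yu=0$. Then for all $a,b\in k$ with $a\neq b$, $$\mathrm{Ext}^1_R(S_a,S_b)=0.$$ *)

(* Defs.v *)
From HB Require Import structures.
From mathcomp Require Import all_boot all_order all_algebra.
From mathcomp Require Import generic_quotient ring_quotient.
From mathcomp Require Import finmap monalg.
From mathcomp Require Import boolp functions.

Set Implicit Arguments.
Unset Strict Implicit.
Unset Printing Implicit Defensive.

Import GRing.Theory.

Local Open Scope ring_scope.
Local Open Scope quotient_scope.

(* Ext of left modules as right derived functor of Hom: for a projective
   resolution P of M, Ext^n(M, N) is the n-th cohomology group of Hom(P, N).   *)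

Section ProjectiveResolutions.
Variable R : pzRingType.

Definition projective (P : lmodType R) : Prop :=
  forall (A B : lmodType R) (f : {linear A -> B}) (g : {linear P -> B}),
    (forall b, exists a, f a = b) ->
    exists h : {linear P -> A}, forall p, f (h p) = g p.

Record proj_resolution (M : lmodType R) := ProjResolution {
  res_obj :> nat -> lmodType R;
  res_diff : forall n, {linear res_obj n.+1 -> res_obj n};
  res_aug : {linear res_obj 0 -> M};
  res_projective : forall n, projective (res_obj n);
  res_aug_surj : forall m, exists p, res_aug p = m;
  res_exact0 : forall p, res_aug p = 0 <-> exists q, res_diff 0 q = p;
  res_exactS : forall n p,
    res_diff n p = 0 <-> exists q, res_diff n.+1 q = p
}.

End ProjectiveResolutions.

Section Ext.
Variables (R : pzRingType) (M : lmodType R).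
Variables (P : proj_resolution M) (N : lmodType R).

Section Cocycles.
Variable n : nat.

Definition cocycle : {pred P n -> N} :=
  fun f => `[< linear f /\ forall p, f (res_diff P n p) = 0 >].

Lemma cocycle_zmod_closed : zmod_closed cocycle.
Proof.
split=> [|f g /asboolP[lf zf] /asboolP[lg zg]]; apply/asboolP.
  by split=> [c u v|p] //=; rewrite scaler0 addr0.
split=> [c u v|p]; last by rewrite !fctE zf zg subrr.
by rewrite !fctE lf lg scalerBr opprD addrACA.
Qed.

HB.instance Definition _ :=
  GRing.isZmodClosed.Build (P n -> N) cocycle cocycle_zmod_closed.

Record cocycles := Cocycles {
  cocycle_fun :> P n -> N;
  cocycle_funP : cocycle_fun \in cocycle
}.

HB.instance Definition _ := [isSub for cocycle_fun].
HB.instance Definition _ := [Choice of cocycles by <:].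
HB.instance Definition _ := [SubChoice_isSubZmodule of cocycles by <:].

End Cocycles.

Definition coboundary (n : nat) : {pred cocycles n} :=
  match n with
  | 0 => fun f => f == 0
  | n'.+1 => fun f =>
      `[< exists g : {linear P n' -> N}, forall p, f p = g (res_diff P n' p) >]
  end.

Lemma coboundary_zmod_closed n : zmod_closed (@coboundary n).
Proof.
case: n => [|n]; split; rewrite /coboundary /=.
- by rewrite unfold_in eqxx.
- by move=> f g; rewrite !unfold_in => /eqP-> /eqP->; rewrite subrr.
- by apply/asboolP; exists \0.
- move=> f g /asboolP[f' f'E] /asboolP[g' g'E]; apply/asboolP.
  by exists (f' \- g') => p /=; rewrite -f'E -g'E.
Qed.

HB.instance Definition _ n :=
  GRing.isZmodClosed.Build (cocycles n) (@coboundary n)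
    (coboundary_zmod_closed n).

Definition Ext (n : nat) : zmodType := Quotient.quot (@coboundary n).

End Ext.

(* Every module has a projective resolution, by iterating the canonical
   surjection from the free module on the elements of a module.               *)

Section FreeCover.
Variables (R : nzRingType) (M : lmodType R).

Definition free_cover (g : {malg R[M]}) : M :=
  \sum_(m <- msupp g) g@_m *: m.

Lemma free_coverEw (d : {fset M}) (g : {malg R[M]}) :
  (msupp g `<=` d)%fset -> free_cover g = \sum_(m <- d) g@_m *: m.
Proof.
move=> le; apply: big_fset_incl => // m _ /mcoeff_outdom ->.
by rewrite scale0r.
Qed.

Lemma free_cover_linear : linear free_cover.
Proof.
move=> c g h; set d := (msupp g `|` msupp h)%fset.
have gd : (msupp g `<=` d)%fset by apply: fsubsetUl.
have hd : (msupp h `<=` d)%fset by apply: fsubsetUr.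
have zd : (msupp (c *: g + h) `<=` d)%fset.
  by apply: fsubset_trans (msuppD_le _ _) _; apply/fsetSU/msuppZ_le.
rewrite (free_coverEw gd) (free_coverEw hd) (free_coverEw zd).
rewrite scaler_sumr -big_split /=; apply: eq_bigr => m _.
by rewrite mcoeffD mcoeffZ scalerDl scalerA.
Qed.

HB.instance Definition _ :=
  GRing.isLinear.Build R {malg R[M]} M _ free_cover free_cover_linear.

Lemma free_cover_surj m : exists g, free_cover g = m.
Proof.
exists << m >>; rewrite (free_coverEw msuppU_le) big_seq_fset1.
by rewrite mcoeffUU scale1r.
Qed.

Lemma free_projective : projective {malg R[M]}.
Proof.
move=> A B f g fsurj.
have [h hE] := boolp.choice (fun m : M => fsurj (g << m >>)).
pose H (p : {malg R[M]}) : A := \sum_(m <- msupp p) p@_m *: h m.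
have HEw (d : {fset M}) (p : {malg R[M]}) : (msupp p `<=` d)%fset ->
    H p = \sum_(m <- d) p@_m *: h m.
  move=> le; apply: big_fset_incl => // m _ /mcoeff_outdom ->.
  by rewrite scale0r.
have Hlin : linear H.
  move=> c p q; set d := (msupp p `|` msupp q)%fset.
  have pd : (msupp p `<=` d)%fset by apply: fsubsetUl.
  have qd : (msupp q `<=` d)%fset by apply: fsubsetUr.
  have zd : (msupp (c *: p + q) `<=` d)%fset.
    by apply: fsubset_trans (msuppD_le _ _) _; apply/fsetSU/msuppZ_le.
  rewrite (HEw _ _ pd) (HEw _ _ qd) (HEw _ _ zd).
  rewrite scaler_sumr -big_split /=; apply: eq_bigr => m _.
  by rewrite mcoeffD mcoeffZ scalerDl scalerA.
pose HL := GRing.isLinear.Build R {malg R[M]} A _ H Hlin.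
pose H' : {linear {malg R[M]} -> A} := HB.pack H HL.
exists H' => p /=; rewrite /H linear_sum [in RHS](monalgE p) linear_sum /=.
apply: eq_bigr => m _; rewrite linearZ /= hE -linearZ; congr (g _).
by apply/malgP => m'; rewrite mcoeffZ !mcoeffU mulrnAr mulr1.
Qed.

Definition syzygy_pred : {pred {malg R[M]}} := fun g => free_cover g == 0.

Lemma syzygy_submod_closed : submod_closed syzygy_pred.
Proof.
split=> [|c g h]; first by apply/eqP; exact: linear0.
by move=> /eqP gE /eqP hE; apply/eqP; rewrite linearP /= gE hE scaler0 addr0.
Qed.

HB.instance Definition _ :=
  GRing.isSubmodClosed.Build R {malg R[M]} syzygy_pred syzygy_submod_closed.

Record syzygy := Syzygy {
  syzygy_val :> {malg R[M]};
  syzygy_valP : syzygy_val \in syzygy_pred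
}.

HB.instance Definition _ := [isSub for syzygy_val].
HB.instance Definition _ := [Choice of syzygy by <:].
HB.instance Definition _ := [SubChoice_isSubLmodule of syzygy by <:].

End FreeCover.

Section FreeResolution.
Variables (R : nzRingType) (M : lmodType R).

Fixpoint nsyzygy (n : nat) : lmodType R :=
  if n is n'.+1 then syzygy (nsyzygy n') else M.

Definition free_res_diff (n : nat) :
    {malg R[nsyzygy n.+1]} -> {malg R[nsyzygy n]} :=
  fun g => val (free_cover g : syzygy (nsyzygy n)).

Lemma free_res_diff_linear n : linear (@free_res_diff n).
Proof. by move=> c g h; rewrite /free_res_diff !linearP. Qed.

HB.instance Definition _ n :=
  GRing.isLinear.Build R {malg R[nsyzygy n.+1]} {malg R[nsyzygy n]} _
    (@free_res_diff n) (@free_res_diff_linear n).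

Lemma free_cover_exact n (p : {malg R[nsyzygy n]}) :
  free_cover p = 0 <-> exists q, @free_res_diff n q = p.
Proof.
split=> [/eqP p0|[q <-]]; last by apply/eqP; exact: syzygy_valP.
have [q qE] := free_cover_surj (Syzygy p0); exists q.
by rewrite /free_res_diff qE.
Qed.

Lemma free_res_diff_exact n (p : {malg R[nsyzygy n.+1]}) :
  @free_res_diff n p = 0 <-> exists q, @free_res_diff n.+1 q = p.
Proof.
rewrite -free_cover_exact; split=> [p0|p0]; last by rewrite /free_res_diff p0.
exact: val_inj.
Qed.

Definition free_resolution : proj_resolution M :=
  @ProjResolution R M (fun n => {malg R[nsyzygy n]}) (@free_res_diff)
    (@free_cover R M) (fun n => @free_projective R (nsyzygy n))
    (@free_cover_surj R M) (@free_cover_exact 0) free_res_diff_exact.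

End FreeResolution.

(* ring_quotient only equips quotients of commutative rings with a product. *)

Section PrincipalQuotient.
Variables (A : nzRingType) (g : A).

Definition two_sided_ideal : {pred A} :=
  fun p => `[< exists s : seq (A * A), p = \sum_(uv <- s) uv.1 * g * uv.2 >].

Lemma two_sided_ideal_zmod_closed : zmod_closed two_sided_ideal.
Proof.
split=> [|p q /asboolP[s ->] /asboolP[t ->]]; apply/asboolP.
  by exists [::]; rewrite big_nil.
exists (s ++ [seq (- uv.1, uv.2) | uv <- t]).
rewrite big_cat big_map /= -sumrN; congr (_ + _).
by apply: eq_bigr => uv _; rewrite !mulNr.
Qed.

HB.instance Definition _ :=
  GRing.isZmodClosed.Build A two_sided_ideal two_sided_ideal_zmod_closed.

Lemma two_sided_idealMl a p : p \in two_sided_ideal -> a * p \in two_sided_ideal.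
Proof.
move=> /asboolP[s ->]; apply/asboolP; exists [seq (a * uv.1, uv.2) | uv <- s].
by rewrite big_map mulr_sumr; apply: eq_bigr => uv _; rewrite !mulrA.
Qed.

Lemma two_sided_idealMr a p : p \in two_sided_ideal -> p * a \in two_sided_ideal.
Proof.
move=> /asboolP[s ->]; apply/asboolP; exists [seq (uv.1, uv.2 * a) | uv <- s].
by rewrite big_map mulr_suml; apply: eq_bigr => uv _; rewrite !mulrA.
Qed.

Definition quot_ring : Type := Quotient.quot two_sided_ideal.

HB.instance Definition _ := GRing.Zmodule.on quot_ring.

Definition to_quot (p : A) : quot_ring := \pi_(Quotient.quot two_sided_ideal) p.

Lemma to_quotB : {morph to_quot : p q / p - q}.
Proof. by move=> p q; rewrite /to_quot !piE. Qed.

Lemma to_quotP p q : to_quot p = to_quot q <-> p - q \in two_sided_ideal.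
Proof. by rewrite Quotient.idealrBE; split=> /eqP. Qed.

Lemma to_quotK p : to_quot (repr (p : Quotient.quot two_sided_ideal)) = p.
Proof. exact: reprK. Qed.

Definition quot_mul (p q : quot_ring) : quot_ring :=
  to_quot (repr (p : Quotient.quot two_sided_ideal) *
           repr (q : Quotient.quot two_sided_ideal)).

Lemma to_quotM p q : quot_mul (to_quot p) (to_quot q) = to_quot (p * q).
Proof.
rewrite /quot_mul; set p' := repr _; set q' := repr _; apply/to_quotP.
have -> : p' * q' - p * q = (p' - p) * q' + p * (q' - q).
  by rewrite mulrBl mulrBr addrA subrK.
apply: rpredD; [apply: two_sided_idealMr | apply: two_sided_idealMl];
  by apply/to_quotP/to_quotK.
Qed.

Lemma quot_ind (Q : quot_ring -> Prop) :
  (forall p, Q (to_quot p)) -> forall p, Q p.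
Proof. by move=> QP p; rewrite -(to_quotK p). Qed.

Lemma to_quotD : {morph to_quot : p q / p + q}.
Proof. by move=> p q; rewrite /to_quot !piE. Qed.

Lemma quot_mulA : associative quot_mul.
Proof.
elim/quot_ind=> p; elim/quot_ind=> q; elim/quot_ind=> r.
by rewrite !to_quotM mulrA.
Qed.

Lemma quot_mul1 : left_id (to_quot 1) quot_mul.
Proof. by elim/quot_ind=> p; rewrite to_quotM mul1r. Qed.

Lemma quot_mulr1 : right_id (to_quot 1) quot_mul.
Proof. by elim/quot_ind=> p; rewrite to_quotM mulr1. Qed.

Lemma quot_mulDl : left_distributive quot_mul +%R.
Proof.
elim/quot_ind=> p; elim/quot_ind=> q; elim/quot_ind=> r.
by rewrite -to_quotD !to_quotM mulrDl to_quotD.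
Qed.

Lemma quot_mulDr : right_distributive quot_mul +%R.
Proof.
elim/quot_ind=> p; elim/quot_ind=> q; elim/quot_ind=> r.
by rewrite -to_quotD !to_quotM mulrDr to_quotD.
Qed.

HB.instance Definition _ := GRing.Zmodule_isPzRing.Build quot_ring
  quot_mulA quot_mul1 quot_mulr1 quot_mulDl quot_mulDr.

Lemma to_quot_is_monoid_morphism : monoid_morphism to_quot.
Proof. by split=> // p q; rewrite -to_quotM. Qed.

HB.instance Definition _ :=
  GRing.isZmodMorphism.Build A quot_ring to_quot to_quotB.
HB.instance Definition _ :=
  GRing.isMonoidMorphism.Build A quot_ring to_quot to_quot_is_monoid_morphism.

End PrincipalQuotient.

Section JordanPlane.
Variable k : fieldType.

Definition free_alg2 := {malg k[{fmonom 'I_2}]}.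
HB.instance Definition _ := GRing.Lalgebra.on free_alg2.

Definition gen_x : free_alg2 := << fmu (0 : 'I_2) >>.
Definition gen_y : free_alg2 := << fmu (1 : 'I_2) >>.

Definition jordan_relation : free_alg2 :=
  gen_x * gen_y - gen_y * gen_x - gen_y ^+ 2.

Definition jordan_plane := quot_ring jordan_relation.
HB.instance Definition _ := GRing.PzRing.on jordan_plane.

Definition jordan_x : jordan_plane := to_quot jordan_relation gen_x.
Definition jordan_y : jordan_plane := to_quot jordan_relation gen_y.
Definition jordan_scalar (c : k) : jordan_plane :=
  to_quot jordan_relation (c%:MP).

Lemma jordan_planeE :
  jordan_x * jordan_y - jordan_y * jordan_x - jordan_y ^+ 2 = 0.
Proof.
rewrite -rmorphXn -!rmorphM -!rmorphB /= -(rmorph0 (to_quot jordan_relation)).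
apply/to_quotP; rewrite subr0 -/jordan_relation; apply/asboolP.
exists [:: (1, 1)]; move: jordan_relation => g.
by rewrite big_seq1 mul1r mulr1.
Qed.

(* The index is only there to select the module structure below. *)
Definition simple_mod (a : k) : Type := k.
HB.instance Definition _ a := GRing.Zmodule.on (simple_mod a).

Section SimpleModule.
Variable a : k.

(* The character of the free algebra with x |-> a and y |-> 0; the module S_a
   is k with the induced action of the quotient ring.                         *)
Definition word_char (m : {fmonom 'I_2}) : k :=
  \prod_(i <- (m : seq 'I_2)) (if i == 0 then a else 0).

Lemma word_char_mmorphism : mmorphism word_char.
Proof.
by split=> [m m'|]; rewrite /word_char ?fmM ?fm1 ?big_cat ?big_nil.
Qed.

HB.instance Definition _ :=
  isMultiplicative.Build {fmonom 'I_2} k word_char word_char_mmorphism.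

Definition free_char : {rmorphism free_alg2 -> k} := mmap idfun word_char.

Lemma free_char_x : free_char gen_x = a.
Proof.
by rewrite /= mmapU mul1r /word_char fmU big_seq1.
Qed.

Lemma free_char_y : free_char gen_y = 0.
Proof. by rewrite /= mmapU mul1r /word_char fmU big_seq1. Qed.

Lemma free_char_relation : free_char jordan_relation = 0.
Proof.
have E (A : nzRingType) (phi : {rmorphism A -> k}) p q :
    phi q = 0 -> phi (p * q - q * p - q ^+ 2) = 0.
  by move=> q0; rewrite expr2 !rmorphB !rmorphM q0 !(mulr0, mul0r) !subrr.
exact: (E free_alg2 free_char gen_x gen_y free_char_y).
Qed.

Lemma free_char_ideal p :
  p \in two_sided_ideal jordan_relation -> free_char p = 0.
Proof.
have fM : {morph free_char : p q / p * q} by exact: rmorphM.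
move=> /asboolP[s ->]; rewrite rmorph_sum big1 // => uv _.
by rewrite fM fM free_char_relation mulr0 mul0r.
Qed.

Definition jordan_char (r : jordan_plane) : k :=
  free_char (repr (r : Quotient.quot (two_sided_ideal jordan_relation))).

Lemma jordan_charE p : jordan_char (to_quot jordan_relation p) = free_char p.
Proof.
apply/eqP; rewrite -subr_eq0 -rmorphB; apply/eqP/free_char_ideal.
exact/to_quotP/to_quotK.
Qed.

Definition simple_act (r : jordan_plane) (v : simple_mod a) : simple_mod a :=
  jordan_char r * (v : k).

Lemma simple_actA r s v : simple_act r (simple_act s v) = simple_act (r * s) v.
Proof.
elim/quot_ind: r => p; elim/quot_ind: s => q.
by rewrite /simple_act -rmorphM !jordan_charE rmorphM mulrA.
Qed.

Lemma simple_act1 : left_id 1 simple_act.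
Proof.
move=> v; rewrite /simple_act -(rmorph1 (to_quot jordan_relation)) jordan_charE.
by rewrite rmorph1 mul1r.
Qed.

Lemma simple_actDr : right_distributive simple_act +%R.
Proof. by move=> r u v; rewrite /simple_act mulrDr. Qed.

Lemma simple_actDl v : {morph simple_act^~ v : r s / r + s}.
Proof.
elim/quot_ind=> p; elim/quot_ind=> q.
by rewrite /simple_act -rmorphD !jordan_charE rmorphD mulrDl.
Qed.

HB.instance Definition _ :=
  GRing.Zmodule_isLmodule.Build jordan_plane (simple_mod a)
    simple_actA simple_act1 simple_actDr simple_actDl.

Definition simple_gen : simple_mod a := (1 : k).

Lemma simple_one_dim (v : simple_mod a) :
  exists! c : k, v = jordan_scalar c *: simple_gen.
Proof.
have E c : jordan_scalar c *: simple_gen = c :> k.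
  by rewrite /GRing.scale /= /simple_act /jordan_scalar jordan_charE mulr1 /= mmapC.
by exists v; split=> [|c]; rewrite E.
Qed.

Lemma simple_x : jordan_x *: simple_gen = jordan_scalar a *: simple_gen.
Proof.
rewrite /GRing.scale /= /simple_act !jordan_charE free_char_x.
by rewrite /= mmapC.
Qed.

Lemma simple_y : jordan_y *: simple_gen = 0.
Proof. by rewrite /GRing.scale /= /simple_act jordan_charE free_char_y mul0r. Qed.

End SimpleModule.

Lemma jordan_plane_nonzero : (1 : jordan_plane) != 0.
Proof.
apply/eqP => /(congr1 (jordan_char 0)).
rewrite -(rmorph1 (to_quot jordan_relation)) -(rmorph0 (to_quot jordan_relation)).
by rewrite !jordan_charE rmorph1 rmorph0 => /eqP; rewrite oner_eq0.
Qed.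

HB.instance Definition _ :=
  GRing.PzSemiRing_isNonZero.Build jordan_plane jordan_plane_nonzero.

End JordanPlane.

(* Main.v *)
From HB Require Import structures.
Require Import Defs.
From mathcomp Require Import all_boot all_order all_algebra.
From mathcomp Require Import ring_quotient finmap monalg.
From mathcomp Require Import boolp.

Set Implicit Arguments.
Unset Strict Implicit.
Unset Printing Implicit Defensive.

Import GRing.Theory.

Local Open Scope ring_scope.

(** In a module over the algebra with [xy - yx = y^2], put [t = x - a].  This
    element kills S_a and acts on S_b as the nonzero scalar [b - a].

    Let [eps : P0 -> S_a] be the augmentation of a projective resolution.  A
    1-cocycle with values in S_b amounts to a linear map [phi] from the kernel
    of [eps] to S_b, and it is a coboundary exactly when [phi] extends to P0.
    Since [t] kills S_a, it maps all of P0 into [ker eps], so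
    [g v = (b - a)^-1 phi (t v)] is defined on P0; on [ker eps] it agrees with
    [phi], because there [phi (t v) = (b - a) phi v]  ([kernel_extension]).

    It remains to see that [g] is linear, that is, [phi (t r v) = r phi (t v)]
    for every [r].  The set of such [r] is a subring, so generators suffice
    ([jordan_plane_ind]).  Scalars and [x] commute with [t]
    ([kernel_map_commuting]).  For [y] one has [t y = y t + y^2 = y (t + y)];
    as [y] also kills S_a, the vector [(t + y) v] lies in [ker eps], and both
    sides vanish because [y] kills S_b  ([kernel_map_normal]). *)

Lemma fmonom_ind (I : choiceType) (Q : {fmonom I} -> Prop) :
  Q mone -> (forall i m, Q m -> Q (mmul (fmu i) m)) -> forall m, Q m.
Proof.
move=> Q1 QM [s]; elim: s => [|i s IHs].
  by have <- : mone = FMonom [::] :> {fmonom I} by apply: val_inj; rewrite /= fm1.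
have -> : FMonom (i :: s) = mmul (fmu i) (FMonom s).
  by apply: val_inj; rewrite /= fmM fmU.
exact: QM.
Qed.

(** The product of the free algebra reaches the quotient through two structures
    that agree only up to conversion; monomials are where the two meet. *)
Lemma to_quot_monomialM (k : fieldType) (c d : k) (m n : {fmonom 'I_2}) :
  to_quot (jordan_relation k) << c * d *g mmul m n >> =
  to_quot (jordan_relation k) << c *g m >>
    * to_quot (jordan_relation k) << d *g n >> :> jordan_plane k.
Proof.
rewrite -[RHS](rmorphM (to_quot (jordan_relation k))); congr to_quot.
by rewrite -fgmulUU -malgM_def.
Qed.

(** Presents the Jordan plane as generated by its scalars, [x] and [y], so that
    properties closed under sums and products are checked on these alone. *)
Lemma jordan_plane_ind (k : fieldType) (Q : jordan_plane k -> Prop) :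
  (forall c, Q (jordan_scalar c)) -> Q (jordan_x k) -> Q (jordan_y k) ->
  (forall r s, Q r -> Q s -> Q (r + s)) ->
  (forall r s, Q r -> Q s -> Q (r * s)) ->
  forall r, Q r.
Proof.
move=> Qc Qx Qy QD QM; elim/quot_ind => p.
have Q0 : Q 0.
  by have := Qc 0; rewrite /jordan_scalar raddf0 (rmorph0 (to_quot _)).
rewrite [p]monalgE (raddf_sum (to_quot (jordan_relation k))).
apply: big_ind => // m _ /=.
rewrite -[p@_m]mulr1 -[X in << _ *g X >>]mul1m to_quot_monomialM.
apply: (QM); first exact: Qc.
elim/fmonom_ind: m => [|i m IHm]; first exact: (Qc 1).
rewrite -[X in << X *g _ >>](mulr1 1) to_quot_monomialM; apply: (QM) => //.
case: i => [[|[|//]] i_lt].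
- by rewrite (_ : Ordinal _ = 0); [exact: Qx | apply: val_inj].
- by rewrite (_ : Ordinal _ = 1); [exact: Qy | apply: val_inj].
Qed.

Lemma jordan_scalar_comm (k : fieldType) (c : k) (r : jordan_plane k) :
  GRing.comm r (jordan_scalar c).
Proof.
have monomialC d (m : {fmonom 'I_2}) :
    GRing.comm (to_quot (jordan_relation k) << d *g m >>) (jordan_scalar c).
  by rewrite /GRing.comm -!to_quot_monomialM mulrC mul1m mulm1.
elim/jordan_plane_ind: r => [d|||r s rC sC|r s rC sC]; try exact: monomialC.
- by rewrite /GRing.comm mulrDl mulrDr rC sC.
- rewrite /GRing.comm -[LHS]mulrA sC [LHS]mulrA rC.
  exact: esym (mulrA (jordan_scalar c) r s).
Qed.

Lemma simple_xE (k : fieldType) (a : k) (v : simple_mod a) :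
  jordan_x k *: v = a * v :> k.
Proof. by rewrite /GRing.scale /= /simple_act jordan_charE free_char_x. Qed.

Lemma simple_yE (k : fieldType) (a : k) (v : simple_mod a) :
  jordan_y k *: v = 0.
Proof. by rewrite /GRing.scale /= /simple_act jordan_charE free_char_y mul0r. Qed.

Lemma simple_scalarE (k : fieldType) (a : k) (c : k) (v : simple_mod a) :
  jordan_scalar c *: v = c * v :> k.
Proof. by rewrite /GRing.scale /= /simple_act jordan_charE /= mmapC. Qed.

Lemma simple_scaleC (k : fieldType) (a : k) (r s : jordan_plane k)
    (v : simple_mod a) :
  r *: (s *: v) = s *: (r *: v).
Proof. exact: mulrCA. Qed.

(** A linear map on the submodule [ker eps], carried by a total function whose
    values off the kernel are arbitrary. *)
Definition linear_on_kernel (R : pzRingType) (M N V : lmodType R)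
    (eps : V -> M) (phi : V -> N) : Prop :=
  forall r p q, eps p = 0 -> eps q = 0 ->
    phi (r *: p + q) = r *: phi p + phi q.

Lemma linear_on_kernelZ (R : pzRingType) (M N V : lmodType R)
    (eps : {linear V -> M}) (phi : V -> N) (r : R) (v : V) :
  linear_on_kernel eps phi ->
  eps v = 0 -> phi (r *: v) = r *: phi v.
Proof.
move=> phi_lin v0; have phi0 : phi 0 = 0.
  have := phi_lin 1 0 0 (linear0 _) (linear0 _).
  by rewrite !scale1r addr0 -{1}[phi 0]addr0 => /addrI/esym.
by rewrite -[r *: v]addr0 phi_lin ?linear0 // phi0 addr0.
Qed.

(** An element [t] that kills M sends V into [ker eps]; if moreover [u] inverts
    its action on N, then [v |-> u phi (t v)] is defined on V and restricts to
    [phi] on [ker eps].  The last two hypotheses are what makes this map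
    linear. *)
Lemma kernel_extension (R : pzRingType) (M N V : lmodType R)
    (eps : {linear V -> M}) (phi : V -> N) (t u : R) :
  linear_on_kernel eps phi ->
  (forall m : M, t *: m = 0) ->
  (forall n : N, u *: (t *: n) = n) ->
  (forall r (n : N), u *: (r *: n) = r *: (u *: n)) ->
  (forall r v, phi (t *: (r *: v)) = r *: phi (t *: v)) ->
  exists g : {linear V -> N}, forall v, eps v = 0 -> g v = phi v.
Proof.
move=> phi_lin tM utN uC phi_t.
have eps_t v : eps (t *: v) = 0 by rewrite linearZ; exact: tM.
pose g v := u *: phi (t *: v).
have g_lin : linear g.
  move=> r p q; rewrite /g scalerDr -[t *: (r *: p)]scale1r.
  by rewrite phi_lin // scale1r phi_t scalerDr uC.
pose gL := GRing.isLinear.Build R V N _ g g_lin.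
pose g' : {linear V -> N} := HB.pack g gL.
by exists g' => v v0; rewrite /= /g (linear_on_kernelZ (eps := eps)) ?utN.
Qed.

Lemma kernel_map_commuting (R : pzRingType) (M N V : lmodType R)
    (eps : {linear V -> M}) (phi : V -> N) (t r : R) :
  linear_on_kernel eps phi ->
  (forall m : M, t *: m = 0) ->
  t * r = r * t ->
  forall v, phi (t *: (r *: v)) = r *: phi (t *: v).
Proof.
move=> phi_lin tM trC v; rewrite scalerA trC -scalerA.
rewrite (linear_on_kernelZ (eps := eps)) //.
by rewrite linearZ; exact: tM.
Qed.

(** Writing [t y = y (t + y)] moves [y] to the left of a vector [(t + y) v] of
    [ker eps], after which both sides are multiples of [y] in N, hence zero. *)
Lemma kernel_map_normal (R : pzRingType) (M N V : lmodType R)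
    (eps : {linear V -> M}) (phi : V -> N) (t y : R) :
  linear_on_kernel eps phi ->
  (forall m : M, t *: m = 0) ->
  (forall m : M, y *: m = 0) ->
  (forall n : N, y *: n = 0) ->
  t * y = y * t + y ^+ 2 ->
  forall v, phi (t *: (y *: v)) = y *: phi (t *: v).
Proof.
move=> phi_lin tM yM yN ty v.
rewrite scalerA ty expr2 -mulrDr -scalerA yN.
rewrite (linear_on_kernelZ (eps := eps)) ?yN //.
by rewrite linearZ /= scalerDl tM yM addr0.
Qed.

(** The defining relation is unchanged when [x] is translated by an element
    commuting with [y]. *)
Lemma jordan_relation_shift (R : pzRingType) (x y c : R) :
  x * y - y * x - y ^+ 2 = 0 -> GRing.comm y c ->
  (x - c) * y = y * (x - c) + y ^+ 2.
Proof.
move=> /subr0_eq xy yc; rewrite mulrBl mulrBr -yc addrAC; congr (_ - _).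
by rewrite -xy addrC subrK.
Qed.

(** The content of the vanishing of Ext^1(S_a, S_b), free of any resolution:
    [x - a] kills S_a and, as [a <> b], acts invertibly on S_b, and the three
    kinds of generators satisfy the compatibility required by
    [kernel_extension]. *)
Lemma simple_kernel_extension (k : fieldType) (a b : k)
    (V : lmodType (jordan_plane k)) (eps : {linear V -> simple_mod a})
    (phi : V -> simple_mod b) :
  a <> b ->
  linear_on_kernel eps phi ->
  exists g : {linear V -> simple_mod b}, forall v, eps v = 0 -> g v = phi v.
Proof.
move=> neq_ab phi_lin; pose t := jordan_x k - jordan_scalar a.
have tE c (v : simple_mod c) : t *: v = (c - a) * v :> k.
  rewrite scalerBl mulrBl.
  by congr (_ - _); [exact: simple_xE | exact: simple_scalarE].
have tM (v : simple_mod a) : t *: v = 0 by rewrite [LHS]tE subrr mul0r.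
have ba0 : b - a != 0 by rewrite subr_eq0 eq_sym; apply/eqP.
have utN (v : simple_mod b) : jordan_scalar (b - a)^-1 *: (t *: v) = v.
  by rewrite [LHS]simple_scalarE tE mulKf.
apply: (kernel_extension phi_lin tM utN).
  exact: simple_scaleC.
have commuting r := kernel_map_commuting (r := r) phi_lin tM.
elim/jordan_plane_ind => [c|||r s phi_r phi_s|r s phi_r phi_s].
- apply: commuting; apply: esym.
  exact: commrB (commr_sym (jordan_scalar_comm _ _)) (jordan_scalar_comm _ _).
- apply: commuting; apply: esym.
  exact: commrB (commr_refl _) (jordan_scalar_comm _ _).
- apply: (kernel_map_normal phi_lin tM); [exact: simple_yE..|].
  exact: jordan_relation_shift (jordan_planeE k) (jordan_scalar_comm _ _).
- move=> v; rewrite ![(r + s) *: _]scalerDl -phi_r -phi_s scalerDr.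
  rewrite -[X in phi (X + _)]scale1r phi_lin ?scale1r //.
    by rewrite linearZ; exact: tM.
  by rewrite linearZ; exact: tM.
- by move=> v; rewrite -!scalerA phi_r phi_s.
Qed.

Theorem corollary6p5 (k : closedFieldType) (chark0 : [pchar k] =i pred0)
    (a b : k) (neq_ab : a <> b)
    (P : @proj_resolution (jordan_plane k) (simple_mod a))
    (e : Ext P (simple_mod b) 1) :
  e = 0.
Proof.
have /asboolP[flin f0] := cocycle_funP (repr e).
have epsD v : (exists q, res_diff P 0 q = v) -> res_aug P v = 0.
  by move=> /res_exact0.
(* The cocycle becomes a map on [ker res_aug] by lifting along [res_diff P 0];
   [fE] makes it independent of the lift. *)
have lift v : exists w, res_aug P v = 0 -> res_diff P 0 w = v.
  have [/res_exact0[w wE]|nv] := EM (res_aug P v = 0); last by exists 0.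
  by exists w.
have [h hE] := boolp.choice lift.
have fE u v : res_diff P 0 u = res_diff P 0 v -> repr e u = repr e v.
  move=> uv; have [q qE] : exists q, res_diff P 1 q = -1 *: v + u.
    by apply/res_exactS; rewrite linearP /= uv scaleN1r addNr.
  by have := f0 q; rewrite qE flin scaleN1r addrC => /eqP; rewrite subr_eq0 => /eqP.
have [g gE] : exists g : {linear P 0 -> simple_mod b},
    forall v, res_aug P v = 0 -> g v = repr e (h v).
  apply: (simple_kernel_extension neq_ab) => r p q p0 q0.
  rewrite -flin; apply: fE.
  by rewrite linearP !hE // linearP /= p0 q0 scaler0 addr0.
suff: repr e - 0 \in @coboundary _ _ P (simple_mod b) 1.
  by rewrite Quotient.idealrBE => /eqP; rewrite reprK => ->; rewrite piE.
rewrite subr0; apply/asboolP; exists g => w.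
rewrite gE; last by apply: epsD; exists w.
by apply: fE; rewrite hE //; apply: epsD; exists w.
Qed.
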